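(* Let $q$ be a power of a prime, let $J$ be a finite-dimensional, associative, nilpotent $\mathbb{F}_q$-algebra, let $G=1+J$ be the corresponding algebra group, and let $\mathsf{S}$ be the double orbit supercharacter theory of $G$. Assume $|G|=q^n$. For each $0\le m\le n$, $G$ has an $\mathsf{S}$-normal ideal subgroup of order $q^m$.
   Context: Given a finite-dimensional, associative, nilpotent $\mathbb{F}_q$-algebra $J$ (nilpotent: $J^k=0$ for some $k$), let $A=\mathbb{F}_q+J$ be the unital algebra obtained by adjoining an identity, so that $J$ is the Jacobson radical of $A$. The set $G=1+J=\{1+x:x\in J\}$ is a subgroup of the unit group of $A$, called an ($\mathbb{F}_q$-)algebra group. The sets $K_g=\{1+x(g-1)y:x,y\in G\}$, $g\in G$, partition $G$. A supercharacter theory of a finite group $G$ is a pair consisting of a partition $\mathcal{X}$ of the set $\mathrm{Irr}(G)$ of complex irreducible characters and a partition $\mathcal{K}$ of $G$ (whose parts are called superclasses, or $\mathsf{S}$-classes) such that $\{1\}\in\mathcal{K}$, $|\mathcal{X}|=|\mathcal{K}|$, and for each $X\in\mathcal{X}$ there is a (nonzero) character with constituents in $X$ that is constant on the parts of $\mathcal{K}$; it is determined by $\mathcal{K}$. It is known (Diaconis--Isaacs) that the sets $K_g$ are the superclasses of a supercharacter theory $\mathsf{S}$ of $G=1+J$, called the double orbit supercharacter theory. A subgroup of $G$ is $\mathsf{S}$-normal if it is a union of $\mathsf{S}$-classes, that is, of sets $K_g$. An ideal subgroup of $G=1+J$ is a subgroup of the form $1+I$, where $I\subseteq J$ is a (two-sided)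 ideal of $A=\mathbb{F}_q+J$, i.e. an ideal of $J$ that is an $\mathbb{F}_q$-subspace. *)

(* Defs.v *)
From HB Require Import structures.
From mathcomp Require Import all_boot all_order all_algebra.
From mathcomp Require Import all_fingroup all_solvable all_field all_character.
Set Implicit Arguments. Unset Strict Implicit. Unset Printing Implicit Defensive.
Import Order.TTheory GRing.Theory Num.Theory.
Local Open Scope ring_scope.

Section Supercharacters.
Local Open Scope group_scope.
Variables (gT : finGroupType) (G : {group gT}).

(* MathComp characters take their values in algC, which contains all the values
   of complex characters of a finite group; sets of irreducible characters are
   represented by sets of indices i : Iirr G for 'chi_i. *)
Record supercharacter_theory := SupercharacterTheory {
  sct_blocks : {set {set Iirr G}};
  superclasses : {set {set gT}};
  sct_blocks_partition : partition sct_blocks [set: Iirr G];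
  superclasses_partition : partition superclasses G;
  superclasses1 : [set 1] \in superclasses;
  sct_card : #|sct_blocks| = #|superclasses|;
  sct_supercharacter : forall X, X \in sct_blocks ->
    exists2 chi : 'CF(G), chi \is a character &
      [/\ chi != 0%R, {subset irr_constt chi <= X} &
          {in superclasses, forall C : {set gT}, {in C &, forall g h, chi g = chi h}}]
}.

(* S-normality of H *)
Definition supernormal (S : supercharacter_theory) (H : {group gT}) :=
  H \subset G /\
  exists2 P : {set {set gT}}, P \subset superclasses S & cover P = H.
End Supercharacters.

(* A partition K of G into conjugation-invariant sets, one of which is {1}, whose
   class sums span a subring of the group algebra is the set of superclasses of a
   (unique) supercharacter theory: two irreducible characters lie in the same
   block iff the corresponding central characters agree on all the class sums. *)
Section SchurRing.
Variables (gT : finGroupType) (G : {group gT}) (K : {set {set gT}}).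
Hypothesis Kpart : partition K G.
Hypothesis K1 : [set 1%g] \in K.
Hypothesis Knorm : forall C a c, C \in K -> a \in G -> c \in C -> (c ^ a)%g \in C.
Definition factorizations (C D : {set gT}) u :=
  [set p : gT * gT | [&& p.1 \in C, p.2 \in D & (p.1 * p.2 == u)%g]].
Hypothesis Kmul : forall C D M u v, C \in K -> D \in K -> M \in K ->
  u \in M -> v \in M -> #|factorizations C D u| = #|factorizations C D v|.

Definition class_sum_value (C : {set gT}) (i : Iirr G) : algC :=
  (\sum_(g in C) 'chi_i g) / 'chi_i 1%g.
Definition same_values : rel (Iirr G) :=
  fun i j => [forall (C | C \in K), class_sum_value C i == class_sum_value C j].
Definition value_blocks := equivalence_partition same_values [set: Iirr G].

Lemma same_valuesP i j :
  reflect {in K, forall C, class_sum_value C i = class_sum_value C j} (same_values i j).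
Proof.
apply: (iffP forallP) => [h C KC|h C]; first by have /implyP/(_ KC)/eqP := h C.
by apply/implyP => /h ->.
Qed.

Lemma same_values_eqv : {in [set: Iirr G] & &, equivalence_rel same_values}.
Proof.
move=> i j k _ _ _; split; first exact/same_valuesP.
move=> /same_valuesP hij; apply/same_valuesP/same_valuesP => h C KC.
  by rewrite -hij ?h.
by rewrite hij ?h.
Qed.

Lemma value_blocks_partition : partition value_blocks [set: Iirr G].
Proof. exact: equivalence_partitionP same_values_eqv. Qed.

Lemma KsubG C : C \in K -> C \subset G.
Proof. by move=> KC; rewrite -(cover_partition Kpart) (bigcup_max C). Qed.

Lemma class_sum_repr C i : C \in K ->
  \sum_(g in C) 'Chi_i g = (class_sum_value C i)%:M.
Proof.
move=> KC; have sCG := KsubG KC.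
have /is_scalar_mxP[a Ea]: is_scalar_mx (\sum_(g in C) 'Chi_i g).
  apply: mx_abs_irr_cent_scalar 'Chi_i _ _ _; first exact/groupC/socle_irr.
  apply/centgmxP => x Gx; rewrite mulmx_suml mulmx_sumr.
  rewrite [RHS](reindex_inj (conjg_inj x)) /=.
  rewrite [RHS](eq_bigl (mem C)); last first.
    move=> g; apply/idP/idP => [h|]; last exact: Knorm.
    by have := Knorm KC (groupVr Gx) h; rewrite conjgK.
  apply: eq_bigr => g Cg; have Gg := subsetP sCG _ Cg.
  by rewrite -!repr_mxM ?groupJ // conjgE !mulgA mulgV mul1g.
rewrite Ea; congr (_%:M); rewrite /class_sum_value.
have -> : \sum_(g in C) 'chi_i g = \tr (\sum_(g in C) 'Chi_i g).
  rewrite raddf_sum; apply: eq_bigr => g Cg.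
  by rewrite -irrRepr cfunE (subsetP sCG _ Cg) mulr1n.
by rewrite Ea mxtrace_scalar irr1_degree -[a *+ _]mulr_natr mulfK // -irr1_degree irr1_neq0.
Qed.

Definition coefK (C D M : {set gT}) : algC :=
  if [pick u in M] is Some u then #|factorizations C D u|%:R else 0.

Lemma class_sum_valueM C D i : C \in K -> D \in K ->
  class_sum_value C i * class_sum_value D i =
  \sum_(M in K) coefK C D M * class_sum_value M i.
Proof.
move=> KC KD.
pose N u : algC := #|factorizations C D u|%:R.
have NE M u : M \in K -> u \in M -> N u = coefK C D M.
  move=> KM Mu; rewrite /coefK; case: pickP => [v Mv|/(_ u)]; last by rewrite Mu.
  by rewrite /N (Kmul KC KD KM Mu Mv).
have E: (\sum_(g in C) 'Chi_i g) *m (\sum_(g in D) 'Chi_i g) =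
     \sum_(M in K) coefK C D M *: (\sum_(g in M) 'Chi_i g).
  have -> : \sum_(M in K) coefK C D M *: (\sum_(g in M) 'Chi_i g) =
            \sum_(u in G) N u *: 'Chi_i u.
    rewrite (set_partition_big _ Kpart) /=.
    apply: eq_bigr => M KM; rewrite scaler_sumr; apply: eq_bigr => u Mu.
    by rewrite (NE M).
  rewrite mulmx_suml; under eq_bigr do rewrite mulmx_sumr.
  rewrite pair_big /=.
  rewrite (partition_big (fun p : gT * gT => p.1 * p.2)%g (mem G)) /=; last first.
    by case=> a b /= /andP[/(subsetP (KsubG KC)) Ga /(subsetP (KsubG KD)) Gb]; rewrite groupM.
  apply: eq_bigr => u Gu.
  rewrite /N scaler_nat -sumr_const; apply: eq_big.
    by move=> p; rewrite inE andbA.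
  move=> p /andP[/andP[Ca Db] /eqP <-].
  have Ga := subsetP (KsubG KC) _ Ca; have Gb := subsetP (KsubG KD) _ Db.
  by apply/esym/repr_mxM.
have n0 : 'chi_i 1%g != 0 := irr1_neq0 i.
move: E; rewrite !class_sum_repr // -scalar_mxM.
rewrite (eq_bigr (fun M => (coefK C D M * class_sum_value M i)%:M)); last first.
  by move=> M KM; rewrite class_sum_repr // scale_scalar_mx.
rewrite -raddf_sum => /(congr1 mxtrace); rewrite !mxtrace_scalar irr1_degree in n0 *.
by rewrite -[X in X = _]mulr_natr -[X in _ = X]mulr_natr => /(mulIf n0).
Qed.

Definition in_span (f : Iirr G -> algC) :=
  exists a : {set gT} -> algC, forall i, f i = \sum_(C in K) a C * class_sum_value C i.

Lemma in_span_ext f g : f =1 g -> in_span f -> in_span g.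
Proof. by move=> E [a h]; exists a => i; rewrite -E. Qed.

Lemma in_spanC C : C \in K -> in_span (class_sum_value C).
Proof.
move=> KC; exists (fun D => (D == C)%:R) => i.
by rewrite (bigD1 C) //= eqxx mul1r big1 ?addr0 // => D /andP[_ /negbTE->]; rewrite mul0r.
Qed.

Lemma in_span1 : in_span (fun=> 1).
Proof.
apply: in_span_ext (in_spanC K1) => i.
by rewrite /class_sum_value big_set1 divff ?irr1_neq0.
Qed.

Lemma in_spanD f g : in_span f -> in_span g -> in_span (fun i => f i + g i).
Proof.
move=> [a Ea] [b Eb]; exists (fun C => a C + b C) => i.
by rewrite Ea Eb -big_split; apply: eq_bigr => C _; rewrite mulrDl.
Qed.

Lemma in_spanZ c f : in_span f -> in_span (fun i => c * f i).
Proof.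
move=> [a Ea]; exists (fun C => c * a C) => i.
by rewrite Ea mulr_sumr; apply: eq_bigr => C _; rewrite mulrA.
Qed.

Lemma in_span_sum (I : finType) (P : pred I) (f : I -> Iirr G -> algC) :
  (forall k, P k -> in_span (f k)) -> in_span (fun i => \sum_(k | P k) f k i).
Proof.
move=> h.
pose s := index_enum I; change (in_span (fun i => \sum_(k <- s | P k) f k i)).
elim: s => [|k s IH].
  by apply: in_span_ext (in_spanZ 0 in_span1) => i; rewrite big_nil mul0r.
case Pk: (P k); last by apply: in_span_ext IH => i; rewrite big_cons Pk.
by apply: in_span_ext (in_spanD (h k Pk) IH) => i; rewrite big_cons Pk.
Qed.

Lemma in_spanM f g : in_span f -> in_span g -> in_span (fun i => f i * g i).
Proof.
move=> [a Ea] [b Eb].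
have: in_span (fun i => \sum_(C in K) \sum_(D in K) (a C * b D) *
   \sum_(M in K) coefK C D M * class_sum_value M i).
  apply: in_span_sum => C KC; apply: in_span_sum => D KD; apply: in_spanZ.
  by apply: in_span_sum => M KM; apply/in_spanZ/in_spanC.
apply: in_span_ext => i; rewrite Ea Eb mulr_suml; apply: eq_bigr => C KC.
rewrite mulr_sumr; apply: eq_bigr => D KD.
by rewrite -class_sum_valueM // mulrACA.
Qed.

Lemma in_span_prod (I : finType) (P : pred I) (f : I -> Iirr G -> algC) :
  (forall k, P k -> in_span (f k)) -> in_span (fun i => \prod_(k | P k) f k i).
Proof.
move=> h.
pose s := index_enum I; change (in_span (fun i => \prod_(k <- s | P k) f k i)).
elim: s => [|k s IH]; first by apply: in_span_ext in_span1 => i; rewrite big_nil.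
case Pk: (P k); last by apply: in_span_ext IH => i; rewrite big_cons Pk.
by apply: in_span_ext (in_spanM (h k Pk) IH) => i; rewrite big_cons Pk.
Qed.

Lemma in_span_block i : in_span (fun j => (same_values i j)%:R).
Proof.
pose sep k C := (C \in K) && (class_sum_value C i != class_sum_value C k).
have sepP k : ~~ same_values i k -> exists C, sep k C.
  by rewrite negb_forall => /existsP[C]; rewrite negb_imply => h; exists C.
pose c k := odflt set0 [pick C | sep k C].
have cP k : ~~ same_values i k -> sep k (c k).
  rewrite /c; case: pickP => [//|no] /sepP[C]; by rewrite no.
pose e k := class_sum_value (c k) i - class_sum_value (c k) k.
have := @in_span_prod _ (fun k => ~~ same_values i k)
  (fun k j => (class_sum_value (c k) j + - class_sum_value (c k) k * 1) * (e k)^-1).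
have H k : ~~ same_values i k ->
    in_span (fun j => (class_sum_value (c k) j + - class_sum_value (c k) k * 1) * (e k)^-1).
  move=> /cP/andP[KC _].
  apply: in_spanM; first exact/in_spanD/in_spanZ/in_span1/in_spanC.
  by apply: in_span_ext (in_spanZ (e k)^-1 in_span1) => j; rewrite mulr1.
move=> /(_ H); apply: in_span_ext => j.
case Eij: (same_values i j).
  rewrite big1 // => k /cP/andP[KC ne].
  rewrite mulr1 -(same_valuesP _ _ Eij) // divff // subr_eq0 //.
rewrite (bigD1 j) ?Eij //= mulr1 subrr !mul0r //.
Qed.

Lemma span_char (a : {set gT} -> algC) i :
  \sum_(C in K) a C * class_sum_value C i =
  (\sum_(g in G) a (pblock K g) * 'chi_i g) / 'chi_i 1%g.
Proof.
rewrite (set_partition_big _ Kpart) /=.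
rewrite mulr_suml; apply: eq_bigr => C KC.
rewrite /class_sum_value mulrA mulr_sumr; congr (_ / _).
by apply: eq_bigr => g Cg; rewrite (def_pblock _ KC Cg) //; exact: partition_trivIset Kpart.
Qed.

Lemma K_block g : g \in G -> pblock K g \in K /\ g \in pblock K g.
Proof.
by move=> Gg; rewrite pblock_mem ?mem_pblock (cover_partition Kpart).
Qed.

Lemma blockJ g x : g \in G -> x \in G -> pblock K (g ^ x)%g = pblock K g.
Proof.
move=> Gg Gx; have [KB Bg] := K_block Gg.
by rewrite (def_pblock _ KB (Knorm KB Gx Bg)) //; exact: partition_trivIset Kpart.
Qed.

Lemma block_cf_subproof (a : {set gT} -> algC) :
  is_class_fun <<G>>%g [ffun g => if g \in G then (a (pblock K g))^* else 0].
Proof.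
rewrite genGid; apply: intro_class_fun => [g x Gg Gx|g /negbTE-> //].
by rewrite groupJr // blockJ.
Qed.
Definition block_cf a : 'CF(G) := Cfun 0 (block_cf_subproof a).

Lemma block_cfE a g : g \in G -> block_cf a g = (a (pblock K g))^*.
Proof. by move=> Gg; rewrite cfunElock Gg. Qed.

Lemma block_cf_dot a i : '['chi_i, block_cf a] =
  #|G|%:R^-1 * ('chi_i 1%g * \sum_(C in K) a C * class_sum_value C i).
Proof.
rewrite span_char [X in _ * X]mulrC divfK ?irr1_neq0 // cfdotE; congr (_ * _).
by apply: eq_bigr => g Gg; rewrite block_cfE // conjCK mulrC.
Qed.

Lemma values_free (a : {set gT} -> algC) :
  (forall i, \sum_(C in K) a C * class_sum_value C i = 0) -> {in K, forall C, a C = 0}.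
Proof.
move=> a0 C KC.
have z : block_cf a = 0.
  rewrite [block_cf a]cfun_sum_cfdot big1 // => i _.
  by rewrite cfdotC block_cf_dot a0 !mulr0 conjC0 scale0r.
have /set0Pn[g Cg] := partition_neq0 Kpart KC.
have := block_cfE a (subsetP (KsubG KC) _ Cg).
rewrite z cfunE (def_pblock _ KC Cg); last exact: partition_trivIset Kpart.
by move/esym/eqP; rewrite conjC_eq0 => /eqP.
Qed.

Lemma value_blocksP X : X \in value_blocks ->
  exists2 i, i \in X & forall j, (j \in X) = same_values i j.
Proof.
case/imsetP => i _ ->; exists i; last by move=> j; rewrite !inE.
by rewrite !inE; apply/same_valuesP.
Qed.

Lemma value_blocks_card : #|value_blocks| = #|K|.
Proof.
pose V := \matrix_(k < #|K|, i < Nirr G) class_sum_value (enum_val k) i.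
pose E := \matrix_(k < #|value_blocks|, i < Nirr G)
            (i \in enum_val k)%:R : 'M[algC]_(_, _).
have freeV : row_free V.
  rewrite -kermx_eq0; apply/rowV0P => v /sub_kermxP v0; apply/rowP => k.
  pose a C := \sum_l v 0 l * (enum_val l == C)%:R.
  have aE l : a (enum_val l) = v 0 l.
    rewrite /a (bigD1 l) //= eqxx mulr1 big1 ?addr0 // => m /negbTE ml.
    by rewrite (inj_eq enum_val_inj) ml mulr0.
  have a0 i : \sum_(C in K) a C * class_sum_value C i = 0.
    move/rowP/(_ i): v0; rewrite !mxE => v0; rewrite -[RHS]v0 [LHS]big_enum_val /=.
    by apply: eq_bigr => l _; rewrite aE mxE.
  by rewrite -aE (values_free a0) ?enum_valP // mxE.
have freeE : row_free E.
  rewrite -kermx_eq0; apply/rowV0P => v /sub_kermxP v0; apply/rowP => k.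
  have [i iX _] := value_blocksP (enum_valP k).
  move/rowP/(_ i): v0; rewrite !mxE (bigD1 k) //= mxE iX mulr1 big1 ?addr0 //.
  move=> l lk; rewrite mxE; case Xi: (i \in enum_val l); last by rewrite mulr0.
  have tI := partition_trivIset value_blocks_partition.
  case/eqP: lk; apply: enum_val_inj.
  by rewrite -(def_pblock tI (enum_valP l) Xi) (def_pblock tI (enum_valP k) iX).
have sVE : (V <= E)%MS.
  apply/row_subP => k; apply/submxP.
  pose r (X : {set Iirr G}) : Iirr G := odflt 0 [pick i in X].
  exists (\row_l class_sum_value (enum_val k) (r (enum_val l))); apply/rowP => i.
  rewrite !mxE.
  have iT : i \in cover value_blocks by rewrite (cover_partition value_blocks_partition) inE.
  have XX := pblock_mem iT; have := iT; rewrite -mem_pblock => iX.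
  set l := enum_rank_in XX (pblock value_blocks i).
  have El : enum_val l = pblock value_blocks i by rewrite enum_rankK_in.
  rewrite (bigD1 l) //= !mxE El iX mulr1 big1 ?addr0.
    have [j jX eqX] := value_blocksP XX.
    rewrite /r; case: pickP => [j' /=|/(_ i)]; last by rewrite iX.
    move: iX; rewrite !eqX => /same_valuesP h1 /same_valuesP h2.
    by rewrite -h1 ?h2 // enum_valP.
  move=> m ml; rewrite !mxE; case Xi: (i \in enum_val m); last by rewrite mulr0.
  case/eqP: ml; apply: enum_val_inj; rewrite El.
  have tI := partition_trivIset value_blocks_partition.
  by rewrite (def_pblock tI (enum_valP m) Xi).
have sEV : (E <= V)%MS.
  apply/row_subP => k; apply/submxP.
  have [i _ eqX] := value_blocksP (enum_valP k).
  have [a Ea] := in_span_block i.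
  exists (\row_l a (enum_val l)); apply/rowP => j; rewrite !mxE eqX Ea.
  by rewrite [LHS]big_enum_val; apply: eq_bigr => l _; rewrite !mxE.
move: freeV freeE; rewrite /row_free => /eqP <- /eqP <-.
by apply/eqP; rewrite eqn_leq !mxrankS.
Qed.

Lemma value_blocks_char X : X \in value_blocks ->
    exists2 chi : 'CF(G), chi \is a character &
      [/\ chi != 0%R, {subset irr_constt chi <= X} &
          {in K, forall C : {set gT}, {in C &, forall g h, chi g = chi h}}].
Proof.
case/value_blocksP => i iX eqX; exists (\sum_(j in X) 'chi_j 1%g *: 'chi_j).
  apply: rpred_sum => j _; rewrite irr1_degree scaler_nat rpredMn //.
  exact: irr_char.
have dotE k : '[\sum_(j in X) 'chi_j 1%g *: 'chi_j, 'chi_k] = 'chi_k 1%g * (k \in X)%:R.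
  rewrite cfdot_suml; case kX: (k \in X); last first.
    rewrite big1 ?mulr0 // => j jX; rewrite cfdotZl cfdot_irr.
    by case: eqP => [E|]; rewrite ?mulr0 // -E jX in kX *.
  rewrite (bigD1 k) //= cfdotZl cfdot_irr eqxx big1 ?addr0 // => j /andP[_ /negbTE jk].
  by rewrite cfdotZl cfdot_irr jk mulr0.
split.
- apply: contraTneq (irr1_neq0 i) => z; have := dotE i.
  by rewrite z cfdot0l iX mulr1 => <-; rewrite eqxx.
- move=> k; rewrite inE dotE; apply: contraNT => /negbTE->; by rewrite mulr0.
move=> C KC g h Cg Ch.
have [a Ea] := in_span_block i.
have -> : \sum_(j in X) 'chi_j 1%g *: 'chi_j = #|G|%:R *: block_cf a.
  rewrite [block_cf a]cfun_sum_cfdot scaler_sumr big_mkcond; apply: eq_bigr => j _.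
  rewrite cfdotC block_cf_dot -Ea -eqX !rmorphM fmorphV !rmorph_nat /=.
  rewrite scalerA mulVKf ?neq0CG // irr1_degree rmorph_nat.
  by case: (j \in X); rewrite ?mulr1 ?mulr0 ?scale0r.
have sCG := subsetP (partitionS Kpart KC); have tI := partition_trivIset Kpart.
have val k : k \in C -> (#|G|%:R *: block_cf a) k = #|G|%:R * (a C)^*.
  by move=> Ck; rewrite cfunE block_cfE ?sCG // (def_pblock tI KC Ck).
by rewrite !val.
Qed.

Definition schur_theory : supercharacter_theory G :=
  SupercharacterTheory value_blocks_partition Kpart K1 value_blocks_card
    value_blocks_char.
End SchurRing.
Section DoubleOrbits.
Variables (A : finUnitRingType) (G : {group {unit A}}).
Implicit Types u g h : {unit A}.

(* K_g = {1 + x (g - 1) y : x, y in G} *)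
Definition double_orbit g : {set {unit A}} :=
  [set h | [exists x in G, exists y in G,
              val h == 1 + val x * (val g - 1) * val y]].

Definition double_orbits : {set {set {unit A}}} :=
  [set double_orbit g | g in G].

Lemma double_orbitP g h : reflect
  (exists x y, [/\ x \in G, y \in G & val h - 1 = val x * (val g - 1) * val y])
  (h \in double_orbit g).
Proof.
rewrite inE; apply: (iffP exists_inP) => [[x Gx /exists_inP[y Gy /eqP->]]|].
  by exists x, y; rewrite addrC addKr.
case=> x [y [Gx Gy E]]; exists x => //; apply/exists_inP; exists y => //.
by rewrite -E addrC subrK.
Qed.

Lemma double_orbit_refl g : g \in double_orbit g.
Proof. by apply/double_orbitP; exists 1%g, 1%g; rewrite group1 mul1r mulr1. Qed.

Lemma double_orbit_sym g h : h \in double_orbit g -> g \in double_orbit h.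
Proof.
case/double_orbitP => x [y [Gx Gy E]]; apply/double_orbitP; exists x^-1%g, y^-1%g.
by rewrite !groupV E /= -!mulrA mulKr ?mulrV ?mulr1 ?(valP x) ?(valP y).
Qed.

Lemma double_orbit_trans g h k :
  h \in double_orbit g -> k \in double_orbit h -> k \in double_orbit g.
Proof.
case/double_orbitP => x [y [Gx Gy E]] /double_orbitP[x' [y' [Gx' Gy' E']]].
apply/double_orbitP; exists (x' * x)%g, (y * y')%g.
by rewrite !groupM // E' E /= !mulrA.
Qed.

Lemma double_orbit_eq g h : h \in double_orbit g -> double_orbit h = double_orbit g.
Proof.
move=> gh; apply/setP => k; apply/idP/idP; first exact: double_orbit_trans.
exact/double_orbit_trans/double_orbit_sym.
Qed.

Hypothesis Gclosed : {in G & &, forall x g y, exists2 h, h \in G &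
  val h = 1 + val x * (val g - 1) * val y}.

Lemma double_orbit_sub g : g \in G -> double_orbit g \subset G.
Proof.
move=> Gg; apply/subsetP => h; rewrite inE => /exists_inP[x Gx /exists_inP[y Gy /eqP E]].
by have [k Gk] := Gclosed Gx Gg Gy; rewrite -E => /val_inj <-.
Qed.

Lemma double_orbits_partition : partition double_orbits G.
Proof.
apply/and3P; split.
- rewrite eqEsubset; apply/andP; split; apply/subsetP => h.
    by case/bigcupP => _ /imsetP[g Gg ->]; apply/subsetP/double_orbit_sub.
  move=> Gh; apply/bigcupP; exists (double_orbit h); last exact: double_orbit_refl.
  exact: imset_f.
- apply/trivIsetP => _ _ /imsetP[g _ ->] /imsetP[h _ ->]; apply: contraNT.
  by case/pred0Pn => k /andP[/double_orbit_eq <- /double_orbit_eq <-].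
- by apply/imsetP => -[g _ E]; have := double_orbit_refl g; rewrite -E inE.
Qed.

Lemma double_orbit1 : double_orbit 1%g = [set 1%g].
Proof.
apply/setP => h; rewrite in_set1; apply/double_orbitP/eqP => [[x [y [_ _]]]|->].
  by rewrite /= subrr mulr0 mul0r => /eqP; rewrite subr_eq0 => /eqP E; apply: val_inj.
by exists 1%g, 1%g; rewrite group1 /= subrr mulr0 mul0r.
Qed.

Lemma double_orbits1 : [set 1%g] \in double_orbits.
Proof. by rewrite -double_orbit1 imset_f ?group1. Qed.

Lemma double_orbit_classE C g :
  C \in double_orbits -> g \in C -> C = double_orbit g.
Proof. by case/imsetP => k _ -> /double_orbit_eq. Qed.

Lemma double_orbit_conj C a c :
  C \in double_orbits -> a \in G -> c \in C -> (c ^ a)%g \in C.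
Proof.
move=> KC Ga Cc; rewrite (double_orbit_classE KC Cc); apply/double_orbitP.
exists a^-1%g, a; rewrite groupV Ga /= mulrBr mulr1 mulrBl mulVr ?(valP a) //.
by rewrite mulrA.
Qed.

Lemma double_orbit_card_factorizations C D M u v :
    C \in double_orbits -> D \in double_orbits ->
    M \in double_orbits -> u \in M -> v \in M ->
  #|factorizations C D u| = #|factorizations C D v|.
Proof.
move=> KC KD KM; move: u v.
suff le u v : u \in M -> v \in M -> (#|factorizations C D u| <= #|factorizations C D v|)%N.
  move=> u v Mu Mv; apply/eqP; rewrite eqn_leq; apply/andP.
  by split; [exact: (le u v Mu Mv)|exact: (le v u Mv Mu)].
move=> Mu Mv; have sG X : X \in double_orbits -> {subset X <= G}.
  by case/imsetP => k Gk ->; apply/subsetP/double_orbit_sub.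
have /double_orbitP[x [y [Gx Gy Ev]]]: v \in double_orbit u.
  by rewrite -(double_orbit_classE KM Mu).
pose t g : {unit A} :=
  odflt 1%g [pick h : {unit A} | val h == 1 + val x * (val g - 1) * val y].
have tE g : g \in G -> val (t g) = 1 + val x * (val g - 1) * val y.
  move=> Gg; rewrite /t; case: pickP => [h /eqP //|no].
  by have [h _ /eqP] := Gclosed Gx Gg Gy; rewrite no.
have tC g : g \in C -> t g \in C.
  move=> Cg; rewrite (double_orbit_classE KC Cg); apply/double_orbitP.
  by exists x, y; split; rewrite // (tE g (sG C KC g Cg)) addrC addKr.
pose f (p : {unit A} * {unit A}) := (t p.1, ((t p.1)^-1 * v)%g).
rewrite -(card_in_imset (f := f)) => [|[g h] [g' h']]; last first.
  rewrite !inE /= => /and3P[Cg _ /eqP <-] /and3P[Cg' _ /eqP E] [/(congr1 val)].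
  rewrite !tE ?(sG C) // => /addrI/(mulIr (valP y))/(mulrI (valP x))/addIr/val_inj.
  by move=> gg' _; move: E; rewrite -gg' => /mulgI->.
apply/subset_leq_card/subsetP => _ /imsetP[[g h] + ->].
rewrite inE /= => /and3P[Cg Dh /eqP Eu]; rewrite inE /= tC // mulKVg eqxx andbT.
rewrite (double_orbit_classE KD Dh); apply/double_orbitP.
exists ((t g)^-1 * x * g)%g, y; split=> //.
  have Gt := sG C KC _ (tC g Cg); have Gg := sG C KC g Cg.
  by apply: groupM Gg; apply: groupM Gx; rewrite groupV.
have Et := tE g (sG C KC g Cg); have Ut := valP (t g).
apply: (mulrI Ut); rewrite mulrBr mulr1 /= !mulrA mulrV // !mul1r.
have -> : val v - val (t g) = (val v - 1) - (val (t g) - 1).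
  by rewrite opprB addrA subrK.
rewrite Ev Et [1 + _ - 1]addrC addKr -mulrBl -mulrBr opprB addrA subrK -Eu /=.
by rewrite -!mulrA; congr (_ * _); rewrite mulrA mulrBr mulr1.
Qed.

End DoubleOrbits.

(* Finite-dimensional (by the Vector structure), associative, not necessarily
   unital, nilpotent F-algebras. The axiom jnilpotent states that all products of
   k + 1 elements vanish for some k, i.e., that J^(k + 1) = 0. *)
HB.mixin Record Vector_isNilpotentAlgebra (F : fieldType) J of Vector F J := {
  jmul : J -> J -> J;
  jmulA : associative jmul;
  jmulDl : left_distributive jmul +%R;
  jmulDr : right_distributive jmul +%R;
  jmulZl : forall (a : F) (x y : J), jmul (a *: x) y = a *: jmul x y;
  jmulZr : forall (a : F) (x y : J), jmul x (a *: y) = a *: jmul x y;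
  jnilpotent : exists k : nat,
    forall (x : J) (s : seq J), size s = k -> foldl jmul x s = 0
}.

#[short(type="nilAlgType")]
HB.structure Definition NilpotentAlgebra (F : fieldType) :=
  { J of Vector_isNilpotentAlgebra F J & Vector F J }.

Section Unitization.
Variables (F : fieldType) (J : nilAlgType F).

(* A = F + J; the pair (a, x) stands for the sum of a * 1 and x. *)
Definition unitization : Type := (F^o * J)%type.

HB.instance Definition _ := Vector.copy unitization (F^o * J)%type.

Implicit Types u v w : unitization.

Definition unitization_one : unitization := (1, 0).
Definition unitization_mul u v : unitization :=
  (u.1 * v.1, (u.1 : F) *: v.2 + (v.1 : F) *: u.2 + jmul u.2 v.2).

Let jmul0l (x : J) : jmul 0 x = 0.
Proof. by rewrite -[X in jmul X](scale0r 0) jmulZl scale0r. Qed.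
Let jmul0r (x : J) : jmul x 0 = 0.
Proof. by rewrite -[X in jmul _ X](scale0r 0) jmulZr scale0r. Qed.

Let mulA : associative unitization_mul.
Proof.
move=> [a x] [b y] [c z]; congr (_, _) => /=; first by rewrite mulrA.
rewrite !(jmulDl, jmulDr, scalerDr, jmulZl, jmulZr, jmulA, scalerA) !addrA.
by rewrite [c * a]mulrC [c * b]mulrC [LHS](ACl (1*2*4*6*3*5*7)%AC).
Qed.
Let mul1 : left_id unitization_one unitization_mul.
Proof. by case=> a x; congr (_, _); rewrite /= ?mul1r // scale1r scaler0 jmul0l !addr0. Qed.
Let mulr1' : right_id unitization_one unitization_mul.
Proof. by case=> a x; congr (_, _); rewrite /= ?mulr1 // scale1r scaler0 jmul0r !addr0 add0r. Qed.
Let mulDl : left_distributive unitization_mul +%R.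
Proof.
move=> [a x] [b y] [c z]; congr (_, _); rewrite /= ?mulrDl //.
by rewrite scalerDl scalerDr jmulDl !addrA; rewrite [LHS](ACl (1*3*5*2*4*6)%AC).
Qed.
Let mulDr : right_distributive unitization_mul +%R.
Proof.
move=> [a x] [b y] [c z]; congr (_, _); rewrite /= ?mulrDr //.
rewrite scalerDl scalerDr jmulDr.
by rewrite [RHS]addrACA; congr (_ + _); rewrite addrACA.
Qed.
Let one_neq0 : unitization_one != 0.
Proof. by apply/eqP => -[] /eqP; rewrite oner_eq0. Qed.

HB.instance Definition _ := GRing.Zmodule_isNzRing.Build unitization
  mulA mul1 mulr1' mulDl mulDr one_neq0.

Let scalerAl' (a : F) u v : a *: (u * v) = (a *: u) * v.
Proof.
case: u v => [b x] [c y]; congr (_, _) => /=; first exact: mulrA.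
by rewrite !scalerDr !scalerA jmulZl [c * a]mulrC.
Qed.
HB.instance Definition _ := GRing.Lmodule_isLalgebra.Build F unitization scalerAl'.
Let scalerAr' (a : F) u v : a *: (u * v) = u * (a *: v).
Proof.
case: u v => [b x] [c y]; congr (_, _) => /=; first exact: mulrCA.
by rewrite !scalerDr !scalerA jmulZr [b * a]mulrC.
Qed.
HB.instance Definition _ := GRing.Lalgebra_isAlgebra.Build F unitization scalerAr'.
HB.instance Definition _ := Algebra_isFalgebra.Build F unitization.
End Unitization.

Notation unitization_units J := {unit (finvect_type (unitization J))}.

Section AlgebraGroup.
Variables (F : finFieldType) (J : nilAlgType F).
(* finvect_type equips A with its structure of finite ring. *)
Local Notation A := (finvect_type (unitization J)).
Implicit Types (u g h : unitization_units J).

Definition jincl (x : J) : A := (0, x).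

Definition algebra_group_set : {set {unit A}} :=
  [set u | [exists x : finvect_type J, val u == 1 + jincl x]].

Lemma mem_algebra_group u : (u \in algebra_group_set) = ((val u).1 == 1).
Proof.
rewrite inE; apply/existsP/eqP => [[x /eqP-> /=]|]; first by rewrite addr0.
case: (val u) => a x /= ->; exists x.
by apply/eqP; congr (_, _); rewrite /= ?addr0 ?add0r.
Qed.

Lemma algebra_group_set_group : group_set algebra_group_set.
Proof.
apply/group_setP; split=> [|u v]; rewrite !mem_algebra_group //=.
by move=> /eqP u1 /eqP v1; rewrite u1 v1 mulr1.
Qed.
Canonical algebra_group := Group algebra_group_set_group.
Local Notation G := algebra_group.

Lemma jincl_nilpotent x : exists k, jincl x ^+ k = 0.
Proof.
have [k Jk] := @jnilpotent F J; exists k.+1.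
rewrite -[0]/(jincl 0) -(Jk x (nseq k x) (size_nseq k x)) {Jk}.
elim: k => [|k IH]; first by rewrite expr1.
rewrite exprSr IH -[in RHS]addn1 nseqD foldl_cat /=.
by congr (_, _); rewrite /= ?mulr0 // !scale0r !add0r.
Qed.

Lemma unipotent_unit (a : A) : a.1 = 1 -> a \is a GRing.unit.
Proof.
move=> a1; have -> : a = 1 - jincl (- a.2).
  by case: a a1 => b x /= ->; congr (_, _); rewrite /= ?subr0 // opprK add0r.
have [k jk] := jincl_nilpotent (- a.2); set j := jincl _ in jk *.
have E : (1 - j) * \sum_(i < k) j ^+ i = 1.
  by apply: oppr_inj; rewrite -mulNr opprB -subrX1 jk sub0r.
have cS : GRing.comm (1 - j) (\sum_(i < k) j ^+ i).
  apply: commr_sum => i _; apply/commr_sym/commrB; first exact: commr1.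
  exact/commr_sym/commrX.
by apply/unitrP; exists (\sum_(i < k) j ^+ i); rewrite -cS E.
Qed.

Lemma algebra_group_closed : {in G & &, forall x g y, exists2 h, h \in G &
  val h = 1 + val x * (val g - 1) * val y}.
Proof.
move=> x g y _ Gg _; set a := 1 + _.
have a1 : a.1 = 1.
  by move: Gg; rewrite mem_algebra_group /= => /eqP->; rewrite subrr mulr0 mul0r addr0.
by exists (Sub a (unipotent_unit a1)); rewrite ?mem_algebra_group SubK ?a1.
Qed.

(* The theory whose superclasses are the sets K_g. *)
Definition double_orbit_theory : supercharacter_theory algebra_group :=
  schur_theory (double_orbits_partition algebra_group_closed)
    (double_orbits1 algebra_group) (@double_orbit_conj _ algebra_group)
    (double_orbit_card_factorizations algebra_group_closed).

(* A two-sided ideal of J that is an F-subspace, i.e., an ideal of A inside J. *)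
Definition nil_ideal (I : {vspace J}) : Prop :=
  forall a x : J, x \in I -> jmul a x \in I /\ jmul x a \in I.

Definition ideal_subgroup (H : {group {unit A}}) : Prop :=
  exists2 I : {vspace J}, nil_ideal I &
    forall u, u \in H <-> exists2 x : J, x \in I & val u = 1 + jincl x.
End AlgebraGroup.

(* Main.v *)
Require Import Defs.
From HB Require Import structures.
From mathcomp Require Import all_boot all_order all_algebra.
From mathcomp Require Import all_fingroup all_solvable all_field all_character.
Set Implicit Arguments. Unset Strict Implicit. Unset Printing Implicit Defensive.
Import Order.TTheory GRing.Theory Num.Theory.

(** For every ideal I of J, the double orbit of 1 + i, with i in I, is
    contained in 1 + I, because x * i * y stays in I for all x and y in A;
    hence the group 1 + I is a union of superclasses, and its order is
    q ^ (\dim I). So it is enough to find an ideal of each dimension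
    m <= \dim J, and these are built by induction on m.

    The inductive step is the usual fact that J annihilates a nonzero vector of
    the nilpotent bimodule J / I when I is a proper ideal: starting from a
    vector outside I, multiply on the left as long as the product stays outside
    I, then do the same on the right. Both processes stop by nilpotency, and the
    second one keeps what the first has achieved because I is a right ideal
    ([ideal_annihilated_vector]). Any line in J / I that J annihilates on both
    sides is an ideal, so adding such a vector to I gives an ideal of dimension
    one more ([exists_ideal_dim]). *)

Local Open Scope ring_scope.

(** A walk that keeps choosing a step inside P is stuck after fewer than k steps.
    The steps are left multiplications, then right multiplications, and P is the
    complement of an ideal. *)
Lemma exists_last_step (T : Type) (A : finType) (f : T -> A -> T) (P : pred T)
    (k : nat) (x : T) :
    P x -> (forall s, size s = k -> ~~ P (foldl f x s)) ->
  exists2 s, P (foldl f x s) & forall a, ~~ P (f (foldl f x s) a).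
Proof.
elim: k x => [|k IH] x Px Pk; first by have := Pk [::] erefl; rewrite /= Px.
have [/existsP[a Pa]|no] := boolP [exists a, P (f x a)]; last first.
  by exists [::] => // a; move: no; rewrite negb_exists => /forallP.
have [s sz|s Ps last] := IH _ Pa; first by apply: (Pk (a :: s)); rewrite /= sz.
by exists (a :: s).
Qed.

Lemma jmul_foldl (F : fieldType) (J : nilAlgType F) (a x : J) (s : seq J) :
  jmul a (foldl (@jmul F J) x s) = foldl (@jmul F J) (jmul a x) s.
Proof. by elim: s x => //= b s IH x; rewrite IH jmulA. Qed.

Lemma foldr_jmul (F : fieldType) (J : nilAlgType F) (a x : J) (s : seq J) :
  foldr (@jmul F J) x (a :: s) = foldl (@jmul F J) a (rcons s x).
Proof.
elim: s a => [//|b s IH] a.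
by rewrite -[LHS]/(jmul a (foldr (@jmul F J) x (b :: s))) IH jmul_foldl.
Qed.

Section Ideals.
Variables (F : finFieldType) (J : nilAlgType F).
Implicit Types (I : {vspace J}) (a v x : J).

Lemma foldl_jmul_ideal I x (s : seq J) :
  nil_ideal I -> x \in I -> foldl (@jmul F J) x s \in I.
Proof. by move=> idI; elim: s x => //= a s IH x /(idI a)[_ /IH]. Qed.

(** The vector v spans a line of J / I that J annihilates on both sides. The
    right multiplications that lead from [v1] to v preserve the inclusion of
    J v1 in I, as (a v1) b1 ... bl is in I when a v1 is. *)
Lemma ideal_annihilated_vector I : nil_ideal I -> I != fullv ->
  exists2 v, v \notin I & forall a, jmul a v \in I /\ jmul v a \in I.
Proof.
move=> idI; rewrite eqEsubv subvf /= => /subvPn[v0 _ Iv0].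
have [k Jk] := @jnilpotent F J.
pose lmul (x : J) (a : finvect_type J) : J := jmul a x.
have [s sz|s Is annl] :=
    exists_last_step (f := lmul) (P := [pred x | x \notin I]) (k := k) Iv0.
  (* An iterated left multiplication is a product of k + 1 factors, the last
     of which is v0. *)
  rewrite /= negbK -(revK s) foldl_rev; move: sz; rewrite -size_rev.
  case: (rev s) => [|a t] sz; last first.
    by rewrite [X in X \in _]foldr_jmul Jk ?mem0v // size_rcons.
  by rewrite [X in X \in _](Jk v0 [::] sz) mem0v.
set v1 := foldl lmul v0 s in Is annl.
pose rmul (x : J) (a : finvect_type J) : J := jmul x a.
have [t sz|t It annr] :=
    exists_last_step (f := rmul) (P := [pred x | x \notin I]) (k := k) Is.
  by rewrite /= negbK (Jk v1 t sz) mem0v.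
exists (foldl rmul v1 t) => // a; split; last by have := annr a; rewrite /= negbK.
rewrite [X in X \in _]jmul_foldl; apply: foldl_jmul_ideal => //.
by have := annl a; rewrite /= negbK.
Qed.

Lemma exists_ideal_dim m : (m <= \dim {:J})%N ->
  exists2 I : {vspace J}, nil_ideal I & \dim I = m.
Proof.
elim: m => [_|m IH lt_m].
  exists 0%VS; last exact: dimv0.
  move=> a x; rewrite memv0 => /eqP->; rewrite !memv0.
  by rewrite -(scale0r 0) jmulZl jmulZr !scale0r eqxx.
have [I idI dimI] := IH (ltnW lt_m).
have [|v Iv annv] := ideal_annihilated_vector idI.
  by apply: contraTneq lt_m => <-; rewrite dimI ltnn.
exists (I + <[v]>)%VS.
  move=> a _ /memv_addP[x Ix [_ /vlineP[c ->] ->]].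
  have [ax xa] := idI a x Ix; have [av va] := annv a.
  by rewrite jmulDl jmulDr jmulZl jmulZr; split;
    apply: (subvP (addvSl _ _)); rewrite memvD ?memvZ.
rewrite dimv_disjoint_sum ?dimI ?dim_vline.
  by case: eqP Iv => [->|_ _]; rewrite ?mem0v ?addn1.
apply/eqP; rewrite -subv0; apply/subvP => x; rewrite memv_cap memv0.
case/andP => Ix /vlineP[c Ex]; move: Ix; rewrite Ex.
have [->|c0] := eqVneq c 0; first by rewrite scale0r.
move/(memvZ c^-1); rewrite scalerA mulVf // scale1r.
by rewrite (negPf Iv).
Qed.

Local Notation A := (finvect_type (unitization J)).
Implicit Types u : unitization_units J.

Definition one_plus I : {set {unit A}} :=
  [set u : {unit A} | ((val u).1 == 1) && ((val u).2 \in I)].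

Lemma one_plusP I u :
  reflect (exists2 x, x \in I & val u = 1 + jincl x) (u \in one_plus I).
Proof.
rewrite inE; apply: (iffP andP) => [[/eqP u1 u2]|[x Ix ->]]; last first.
  by rewrite /= addr0 add0r.
exists (val u).2 => //; case: (val u) u1 => a x /= ->.
by congr (_, _); rewrite /= ?addr0 ?add0r.
Qed.

Lemma jincl_ideal I (a b : A) x : nil_ideal I -> x \in I ->
  exists2 y, y \in I & a * jincl x * b = jincl y.
Proof.
move=> idI Ix; pose y : J := (a * jincl x).2.
have Iy : y \in I.
  by rewrite /y /= scale0r addr0 memvD ?memvZ //; have [] := idI a.2 x Ix.
have -> : a * jincl x = jincl y by congr (_, _); rewrite /= mulr0.
exists (jincl y * b).2; last by congr (_, _); rewrite /= mul0r.
by rewrite /= scale0r add0r memvD ?memvZ //; have [] := idI b.2 y Iy.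
Qed.

Lemma one_plus_group_set I : nil_ideal I -> group_set (one_plus I).
Proof.
move=> idI; apply/group_setP; split=> [|u v].
  by rewrite inE /= eqxx mem0v.
rewrite !inE => /andP[/eqP u1 Iu] /andP[/eqP v1 Iv].
rewrite /= u1 v1 mulr1 eqxx !scale1r !memvD //.
by have [_] := idI (val v).2 _ Iu.
Qed.

Lemma one_plus_sub I : one_plus I \subset algebra_group J.
Proof. by apply/subsetP => u; rewrite inE mem_algebra_group => /andP[]. Qed.

Lemma one_plus_fullv : one_plus fullv = algebra_group J.
Proof. by apply/setP => u; rewrite inE mem_algebra_group memvf andbT. Qed.

Lemma card_one_plus I : #|one_plus I| = (#|F| ^ \dim I)%N.
Proof.
pose proj u : finvect_type J := (val u).2.
have proj_inj : {in one_plus I &, injective proj}.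
  move=> u v; rewrite !inE => /andP[/eqP u1 _] /andP[/eqP v1 _] E.
  apply: val_inj; rewrite /= [val u]surjective_pairing [val v]surjective_pairing.
  by rewrite u1 v1; congr (_, _).
rewrite -(card_in_imset proj_inj).
rewrite -(@card_vspace F (finvect_type J)); apply: eq_card => x.
apply/imsetP/idP => [[u]|Ix]; first by rewrite inE => /andP[_ Iu] ->.
pose a : A := (1, x); have Ua : a \is a GRing.unit by apply: unipotent_unit.
by exists (Sub a Ua); rewrite ?inE /proj /= ?SubK ?eqxx.
Qed.

(** Double orbits in the group 1 + J do not leave 1 + I, as I absorbs the
    multiplications by A on both sides. *)
Lemma one_plus_supernormal I (H : {group {unit A}}) : nil_ideal I ->
  H = one_plus I :> {set _} -> supernormal (double_orbit_theory J) H.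
Proof.
move=> idI EH; have sHG : H \subset algebra_group J by rewrite EH one_plus_sub.
split=> //; exists [set double_orbit (algebra_group J) g | g in H].
  exact: imsetS.
rewrite cover_imset; apply/eqP; rewrite eqEsubset; apply/andP; split; last first.
  by apply/subsetP => g Hg; apply/bigcupP; exists g => //; apply: double_orbit_refl.
apply/bigcupsP => g; rewrite EH => /one_plusP[i Ii Eg]; apply/subsetP => h.
case/double_orbitP => x [y [_ _]]; rewrite Eg [1 + jincl i]addrC addrK => Eh.
have [j Ij Ej] := jincl_ideal (val x) (val y) idI Ii.
by apply/one_plusP; exists j => //; rewrite -Ej -Eh addrC subrK.
Qed.

End Ideals.

Local Close Scope ring_scope.

Theorem theorem4 (q : nat) (F : finFieldType) (hF : #|F| = q) (J : nilAlgType F)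
  (n m : nat) (hG : #|algebra_group J| = (q ^ n)%N) (hm : (m <= n)%N) :
  exists H : {group unitization_units J},
    [/\ H \subset algebra_group J, ideal_subgroup H,
     supernormal (double_orbit_theory J) H & #|H| = (q ^ m)%N].
Proof.
have dimJ : \dim {:J} = n.
  have q_gt1 : 1 < q by rewrite -hF finNzRing_gt1.
  by apply: (expnI q_gt1); rewrite -hG -one_plus_fullv card_one_plus hF.
have [|I idI dimI] := @exists_ideal_dim F J m; first by rewrite dimJ.
pose H := Group (one_plus_group_set idI).
exists H; split.
- exact: one_plus_sub.
- by exists I => // u; split=> /one_plusP.
- exact: (one_plus_supernormal (H := H) idI).
- by rewrite card_one_plus dimI hF.
Qed.
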